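(* Let $\Lambda$ and $\Gamma$ be left and right noetherian rings, let ${}_{\Lambda}U_{\Gamma}$ be a faithfully balanced selforthogonal bimodule with ${}_{\Lambda}U$ and $U_{\Gamma}$ finitely generated, and let $k$ be a positive integer. If $\mathrm{grade}_U\mathrm{Ext}^{i+1}_{\Lambda}(M,U)\geq i$ for any $M\in\mathrm{mod}\,\Lambda$ and $1\leq i\leq k-1$, then each $k$-syzygy module in $\mathrm{mod}\,\Lambda$ is in $\Omega^k_U(\mathrm{mod}\,\Lambda)$.
   Context: $\mathrm{mod}\,\Lambda$ is the category of finitely generated left $\Lambda$-modules and $\mathrm{mod}\,\Gamma^{op}$ the category of finitely generated right $\Gamma$-modules. For $M\in\mathrm{mod}\,\Lambda$, $\mathrm{Ext}^i_{\Lambda}(M,U)$ is a right $\Gamma$-module. ${}_{\Lambda}U_{\Gamma}$ is faithfully balanced if the natural maps $\Lambda\to\mathrm{End}(U_{\Gamma})$ and $\Gamma\to\mathrm{End}({}_{\Lambda}U)^{op}$ are isomorphisms; it is selforthogonal if $\mathrm{Ext}^i_{\Lambda}({}_{\Lambda}U,{}_{\Lambda}U)=0$ and $\mathrm{Ext}^i_{\Gamma}(U_{\Gamma},U_{\Gamma})=0$ for all $i\geq 1$. For $A\in\mathrm{mod}\,\Gamma^{op}$, $\mathrm{grade}_U A\geq i$ means $\mathrm{Ext}^j_{\Gamma}(A,U)=0$ for all $0\leq j<i$ (with $\mathrm{Ext}^0=\mathrm{Hom}$). $\mathrm{add}_{\Lambda}U$ is the full subcategory of $\mathrm{mod}\,\Lambda$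 of modules isomorphic to direct summands of finite direct sums of copies of ${}_{\Lambda}U$. A module $M\in\mathrm{mod}\,\Lambda$ is called $U$-$k$-syzygy if there is an exact sequence $0\to M\to X_0\to X_1\to\cdots\to X_{k-1}$ in $\mathrm{mod}\,\Lambda$ with all $X_i\in\mathrm{add}_{\Lambda}U$; $\Omega^k_U(\mathrm{mod}\,\Lambda)$ is the full subcategory of $U$-$k$-syzygy modules. A $k$-syzygy module is a module $M\in \mathrm{mod}\,\Lambda$ for which there is an exact sequence $0\to M\to P_0\to\cdots\to P_{k-1}$ with all $P_i$ finitely generated projective. *)

(* Defs.v *)
From HB Require Import structures.
From mathcomp Require Import all_boot all_order all_algebra.
From mathcomp Require Import generic_quotient ring_quotient finmap.
From mathcomp Require Import boolp classical_sets functions cardinality fsbigop.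

Set Implicit Arguments.
Unset Strict Implicit.
Unset Printing Implicit Defensive.

Import GRing.Theory.
Local Open Scope ring_scope.
Local Open Scope quotient_scope.

(* Left R-modules are [lmodType R]; right R-modules are [lmodType R^c]. *)

Definition is_surjective (X Y : Type) (f : X -> Y) := forall y, exists x, f x = y.

Definition exact_at (X Y : Type) (Z : zmodType) (f : X -> Y) (g : Y -> Z) :=
  forall y, g y = 0 <-> exists x, f x = y.

Definition trivial_module (M : zmodType) := forall x : M, x = 0.

Section FinitenessConditions.
Variable R : pzRingType.

Definition generated_by (M : lmodType R) (S : {pred M}) n (e : 'I_n -> M) :=
  (forall i, e i \in S) /\
  forall x, x \in S -> exists c : 'I_n -> R, x = \sum_i c i *: e i.

Definition fin_gen (M : lmodType R) :=
  exists n (e : 'I_n -> M), generated_by predT e.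

Definition left_noetherian :=
  forall I : {pred R^o}, submod_closed I ->
  exists n (e : 'I_n -> R^o), generated_by I e.

Definition projective (P : lmodType R) :=
  forall (A B : lmodType R) (g : {linear A -> B}) (f : {linear P -> B}),
    is_surjective g -> exists h : {linear P -> A}, forall x, g (h x) = f x.

End FinitenessConditions.

Definition right_noetherian (R : pzRingType) := left_noetherian R^c.

(* Bimodules: left R-modules with a commuting right action of S. *)
HB.mixin Record Lmodule_isBimodule (R S : pzRingType) U of GRing.Lmodule R U := {
  rscale : U -> S -> U;
  rscaleA : forall u a b, rscale (rscale u a) b = rscale u (a * b);
  rscale1 : forall u, rscale u 1 = u;
  rscaleDl : forall a, {morph rscale^~ a : u v / u + v};
  rscaleDr : forall u, {morph rscale u : a b / a + b};
  rscaleC : forall (r : R) u a, rscale (r *: u) a = r *: rscale u a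
}.

#[short(type="bimodType")]
HB.structure Definition Bimodule (R S : pzRingType) :=
  {U of Lmodule_isBimodule R S U & GRing.Lmodule R U}.

(* The R-S-bimodule U seen as an S^c-R^c-bimodule, i.e. with its right action
   as the main one. *)
Definition right_mod (R S : pzRingType) (U : bimodType R S) : Type := U.

Section RightMod.
Variables (R S : pzRingType) (U : bimodType R S).

HB.instance Definition _ := GRing.Zmodule.on (right_mod U).

Definition right_mod_scale (a : S^c) (u : right_mod U) : right_mod U :=
  @rscale R S U u a.

Fact right_mod_scaleA a b u :
  right_mod_scale a (right_mod_scale b u) = right_mod_scale (a * b) u.
Proof. exact: rscaleA. Qed.

Fact right_mod_scale1 : left_id 1 right_mod_scale.
Proof. exact: rscale1. Qed.

Fact right_mod_scaleDr : right_distributive right_mod_scale +%R.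
Proof. by move=> a u v; exact: rscaleDl. Qed.

Fact right_mod_scaleDl u : {morph right_mod_scale^~ u : a b / a + b}.
Proof. by move=> a b; exact: rscaleDr. Qed.

HB.instance Definition _ := GRing.Zmodule_isLmodule.Build S^c (right_mod U)
  right_mod_scaleA right_mod_scale1 right_mod_scaleDr right_mod_scaleDl.

Definition right_mod_rscale (u : right_mod U) (r : R^c) : right_mod U :=
  (r : R) *: (u : U).

Fact right_mod_rscaleA u a b :
  right_mod_rscale (right_mod_rscale u a) b = right_mod_rscale u (a * b).
Proof. exact: (@scalerA R U b a u). Qed.

Fact right_mod_rscale1 u : right_mod_rscale u 1 = u.
Proof. exact: (@scale1r R U u). Qed.

Fact right_mod_rscaleDl a : {morph right_mod_rscale^~ a : u v / u + v}.
Proof. by move=> u v; exact: (@scalerDr R U a u v). Qed.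

Fact right_mod_rscaleDr u : {morph right_mod_rscale u : a b / a + b}.
Proof. by move=> a b; exact: (@scalerDl R U u a b). Qed.

Fact right_mod_rscaleC (s : S^c) u r :
  right_mod_rscale (s *: u) r = s *: right_mod_rscale u r.
Proof. by symmetry; exact: rscaleC. Qed.

HB.instance Definition _ := Lmodule_isBimodule.Build S^c R^c (right_mod U)
  right_mod_rscaleA right_mod_rscale1 right_mod_rscaleDl right_mod_rscaleDr
  right_mod_rscaleC.

End RightMod.

(* Hom_R(M, N), a right S-module when N is an R-S-bimodule. *)
Definition lin_hom (R : pzRingType) (M N : lmodType R) : Type := {linear M -> N}.

Section HomGroup.
Variables (R : pzRingType) (M N : lmodType R).

Definition hom_fun (f : lin_hom M N) : {linear M -> N} := f.

HB.instance Definition _ := gen_eqMixin (lin_hom M N).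
HB.instance Definition _ := gen_choiceMixin (lin_hom M N).

Lemma homP (f g : lin_hom M N) : hom_fun f =1 hom_fun g -> f = g.
Proof.
case: f g => f [[zf] [sf]] [g [[zg] [sg]]] /= /funext fg.
move: zf sf zg sg; rewrite fg => *.
congr GRing.Linear.Pack; congr GRing.Linear.Class;
 by [congr GRing.isNmodMorphism.Axioms_; exact: Prop_irrelevance
    |congr GRing.isScalable.Axioms_; exact: Prop_irrelevance].
Qed.

Definition hom_zero : lin_hom M N := \0.
Definition hom_opp (f : lin_hom M N) : lin_hom M N := \- hom_fun f.
Definition hom_add (f g : lin_hom M N) : lin_hom M N := hom_fun f \+ hom_fun g.

Fact hom_addA : associative hom_add.
Proof. by move=> f g h; apply: homP => x; exact: addrA. Qed.
Fact hom_addC : commutative hom_add.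
Proof. by move=> f g; apply: homP => x; exact: addrC. Qed.
Fact hom_add0 : left_id hom_zero hom_add.
Proof. by move=> f; apply: homP => x; exact: add0r. Qed.
Fact hom_addN : left_inverse hom_zero hom_opp hom_add.
Proof. by move=> f; apply: homP => x; exact: addNr. Qed.

HB.instance Definition _ :=
  GRing.isZmodule.Build (lin_hom M N) hom_addA hom_addC hom_add0 hom_addN.

End HomGroup.

Section HomModule.
Variables (R S : pzRingType) (M : lmodType R) (N : bimodType R S).

Definition hom_scale_fun (a : S^c) (f : lin_hom M N) (x : M) : N :=
  rscale (hom_fun f x) a.

Fact hom_scale_is_linear a f : linear (hom_scale_fun a f).
Proof.
by move=> r x y; rewrite /hom_scale_fun linearP rscaleDl rscaleC.
Qed.

HB.instance Definition _ a f :=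
  GRing.isLinear.Build R M N _ (hom_scale_fun a f) (hom_scale_is_linear a f).

Definition hom_scale (a : S^c) (f : lin_hom M N) : lin_hom M N := hom_scale_fun a f.

Fact hom_scaleA a b f : hom_scale a (hom_scale b f) = hom_scale (a * b) f.
Proof. by apply: homP => x; exact: rscaleA. Qed.
Fact hom_scale1 : left_id 1 hom_scale.
Proof. by move=> f; apply: homP => x; exact: rscale1. Qed.
Fact hom_scaleDr : right_distributive hom_scale +%R.
Proof. by move=> a f g; apply: homP => x; exact: rscaleDl. Qed.
Fact hom_scaleDl f : {morph hom_scale^~ f : a b / a + b}.
Proof. by move=> a b; apply: homP => x; exact: rscaleDr. Qed.

HB.instance Definition _ := GRing.Zmodule_isLmodule.Build S^c (lin_hom M N)
  hom_scaleA hom_scale1 hom_scaleDr hom_scaleDl.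

End HomModule.

Section HomPrecomp.
Variables (R S : pzRingType) (M M' : lmodType R) (N : bimodType R S).
Variable d : {linear M' -> M}.

Definition hom_precomp (f : lin_hom M N) : lin_hom M' N := hom_fun f \o d.

Fact hom_precomp_is_linear : linear hom_precomp.
Proof. by move=> a f g; apply: homP. Qed.

HB.instance Definition _ :=
  GRing.isLinear.Build S^c (lin_hom M N) (lin_hom M' N) _ hom_precomp
    hom_precomp_is_linear.
End HomPrecomp.
Arguments hom_precomp {R S M M'} N d f.

Section Kernel.
Variables (R : pzRingType) (A B : lmodType R) (g : {linear A -> B}).

Definition ker_pred : {pred A} := [pred x | g x == 0].

Lemma ker_predP x : reflect (g x = 0) (x \in ker_pred).
Proof. exact: eqP. Qed.

Fact ker_pred_closed : subsemimod_closed ker_pred.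
Proof.
split; first split=> [|x y]; rewrite ?inE ?linear0 //.
  by rewrite linearD => /eqP-> /eqP->; rewrite addr0.
by move=> a x; rewrite !inE linearZ => /eqP /= ->; rewrite scaler0.
Qed.

Record ker := Ker { ker_val :> A; _ : ker_val \in ker_pred }.

HB.instance Definition _ := [isSub for ker_val].
HB.instance Definition _ := [Choice of ker by <:].
HB.instance Definition _ :=
  GRing.SubChoice_isSubLmodule.Build R A ker_pred ker ker_pred_closed.

End Kernel.

(* ker g / (ker g :&: im f) for A --f--> B --g--> C; in a complex im f is
   contained in ker g. *)
Section Homology.
Variables (R : pzRingType) (A B C : lmodType R).
Variables (f : {linear A -> B}) (g : {linear B -> C}).

Definition im_pred : {pred ker g} := fun z => `[< exists x, f x = \val z >].

Fact im_pred_zmod : zmod_closed im_pred.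
Proof.
split=> [|y z /asboolP[y' fy] /asboolP[z' fz]]; apply/asboolP.
  by exists 0; rewrite !raddf0.
by exists (y' - z'); rewrite !raddfB /= fy fz.
Qed.

HB.instance Definition _ := GRing.isZmodClosed.Build (ker g) im_pred im_pred_zmod.

Lemma im_predZ a z : z \in im_pred -> a *: z \in im_pred.
Proof.
move=> /asboolP[z' fz]; apply/asboolP; exists (a *: z').
by rewrite linearZ /= fz.
Qed.

Definition homology : Type := Quotient.quot im_pred.
Definition homology_class (z : ker g) : homology := \pi_(Quotient.quot im_pred) z.

HB.instance Definition _ := GRing.Zmodule.on homology.

Definition homology_scale (a : R) (x : homology) : homology :=
  homology_class (a *: repr x).

Lemma homology_class_eq (y z : ker g) :
  homology_class y = homology_class z <-> y - z \in im_pred.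
Proof. by rewrite Quotient.idealrBE; split=> /eqP. Qed.

Lemma homology_class_repr (x : homology) : homology_class (repr x) = x.
Proof. exact: reprK. Qed.

Lemma homology_classD (y z : ker g) :
  homology_class (y + z) = homology_class y + homology_class z.
Proof. by rewrite /homology_class raddfD. Qed.

Lemma homology_class_eq0 (z : ker g) :
  homology_class z = 0 <-> exists x, f x = \val z.
Proof.
have -> : 0 = homology_class 0 by rewrite /homology_class raddf0.
by rewrite homology_class_eq subr0; split=> [/asboolP//|?]; apply/asboolP.
Qed.

Lemma homology_classZ a (y : ker g) :
  homology_class (a *: y) = homology_scale a (homology_class y).
Proof.
apply/homology_class_eq; rewrite -scalerBr; apply: im_predZ.
by apply/homology_class_eq; rewrite homology_class_repr.
Qed.

Fact homology_scaleA a b x :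
  homology_scale a (homology_scale b x) = homology_scale (a * b) x.
Proof. by rewrite -[x]homology_class_repr -!homology_classZ scalerA. Qed.
Fact homology_scale1 : left_id 1 homology_scale.
Proof. by move=> x; rewrite -[x]homology_class_repr -homology_classZ scale1r. Qed.
Fact homology_scaleDr : right_distributive homology_scale +%R.
Proof.
move=> a x y; rewrite -[x]homology_class_repr -[y]homology_class_repr.
by rewrite -homology_classD -!homology_classZ -homology_classD scalerDr.
Qed.
Fact homology_scaleDl x : {morph homology_scale^~ x : a b / a + b}.
Proof.
move=> a b; rewrite -[x]homology_class_repr.
by rewrite -!homology_classZ -homology_classD scalerDl.
Qed.

HB.instance Definition _ := GRing.Zmodule_isLmodule.Build R homology
  homology_scaleA homology_scale1 homology_scaleDr homology_scaleDl.

End Homology.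

(* The free module on a set X: finitely supported functions X -> R. *)
Section FreeModule.
Variables (R : pzRingType) (X : choiceType).

Definition finsupp_pred : {pred X -> R^o} :=
  fun f => `[< exists A : {fset X}, forall x, x \notin A -> f x = 0 >].

Fact finsupp_closed : subsemimod_closed finsupp_pred.
Proof.
split; first split.
- by apply/asboolP; exists fset0.
- move=> f g /asboolP[A fA] /asboolP[B gB]; apply/asboolP.
  exists (A `|` B)%fset => x; rewrite finmap.inE negb_or => /andP[xA xB].
  by rewrite [LHS](_ : _ = f x + g x)// fA // gB // addr0.
- move=> a f /asboolP[A fA]; apply/asboolP; exists A => x xA.
  by rewrite [LHS](_ : _ = a *: f x)// fA // scaler0.
Qed.

Record free_mod := Free { free_val :> X -> R^o; _ : free_val \in finsupp_pred }.

HB.instance Definition _ := [isSub for free_val].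
HB.instance Definition _ := [Choice of free_mod by <:].
HB.instance Definition _ := GRing.SubChoice_isSubLmodule.Build R (X -> R^o)
  finsupp_pred free_mod finsupp_closed.

Lemma free_supp (f : free_mod) : exists A : {fset X}, forall x, x \notin A -> f x = 0.
Proof. by case: f => f /= /asboolP. Qed.

Variables (M : lmodType R) (h : X -> M).

Definition free_lift (f : free_mod) : M := \sum_(x \in [set: X]) (f x : R) *: h x.

Lemma free_liftE (f : free_mod) (A : {fset X}) : (forall x, x \notin A -> f x = 0) ->
  free_lift f = \sum_(x <- A) (f x : R) *: h x.
Proof. by move=> fA; apply: fsbigTE => x /fA ->; rewrite scale0r. Qed.

Fact free_lift_is_linear : linear free_lift.
Proof.
move=> a f g; have [A fA] := free_supp f; have [B gB] := free_supp g.
pose C := (A `|` B)%fset.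
have fC x : x \notin C -> f x = 0 by rewrite finmap.inE negb_or => /andP[/fA].
have gC x : x \notin C -> g x = 0 by rewrite finmap.inE negb_or => /andP[_ /gB].
rewrite (free_liftE fC) (free_liftE gC) (@free_liftE _ C); last first.
  by move=> x xC; rewrite [LHS](_ : _ = a *: f x + g x)// fC // gC // scaler0 addr0.
rewrite scaler_sumr -big_split; apply: eq_bigr => x _ /=.
by rewrite [X in X *: _](_ : _ = a * f x + g x)// scalerDl scalerA.
Qed.

HB.instance Definition _ :=
  GRing.isLinear.Build R free_mod M _ free_lift free_lift_is_linear.

End FreeModule.

Section FreeBasis.
Variables (R : pzRingType) (X : choiceType).

Fact free_gen_finsupp (x : X) :
  (fun y => (y == x)%:R : R^o) \in @finsupp_pred R X.
Proof.
apply/asboolP; exists [fset x]%fset => y.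
by rewrite finmap.inE => /negPf ->.
Qed.

Definition free_gen (x : X) : free_mod R X := Free (free_gen_finsupp x).

Lemma free_lift_gen (M : lmodType R) (h : X -> M) x :
  free_lift h (free_gen x) = h x.
Proof.
rewrite (@free_liftE _ _ _ h _ [fset x]%fset); last first.
  by move=> y; rewrite finmap.inE => /negPf /= ->.
by rewrite finmap.big_seq_fset1 /= eqxx scale1r.
Qed.

Lemma free_genE (f : free_mod R X) : f = free_lift free_gen f.
Proof.
have [A fA] := free_supp f; rewrite (free_liftE _ fA).
apply: val_inj; apply/funext => y; rewrite raddf_sum fct_sumE /=.
have [yA|yA] := boolP (y \in A); last first.
  rewrite (fA _ yA) big1_seq // => x /andP[_ xA].
  rewrite [LHS](_ : _ = f x * (y == x)%:R)//.
  by rewrite (_ : y == x = false) ?mulr0 //; apply: contraNF yA => /eqP->.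
rewrite (big_fsetD1 y) //= big1_seq ?addr0 => [|x /=].
  by rewrite [RHS](_ : _ = f y * (y == y)%:R)// eqxx mulr1.
rewrite !finmap.inE => /andP[xy _].
by rewrite [LHS](_ : _ = f x * (y == x)%:R)// eq_sym (negPf xy) mulr0.
Qed.

Lemma free_hom_eq (M : lmodType R) (u v : {linear free_mod R X -> M}) :
  (forall x, u (free_gen x) = v (free_gen x)) -> u =1 v.
Proof.
move=> uv f; have [A fA] := free_supp f.
rewrite [f]free_genE (free_liftE _ fA) !linear_sum.
by apply: eq_bigr => x _; rewrite !linearZ_LR uv.
Qed.

Lemma free_projective : projective (free_mod R X).
Proof.
move=> A B g f gsurj; have [h hP] := choice (fun x => gsurj (f (free_gen x))).
exists (free_lift h : {linear _ -> _}) => y.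
by apply: (@free_hom_eq _ (g \o free_lift h) f) => x /=; rewrite free_lift_gen.
Qed.

End FreeBasis.

Record proj_resolution (R : pzRingType) (M : lmodType R) := ProjResolution {
  res_mod : nat -> lmodType R;
  res_diff : forall n, {linear res_mod n.+1 -> res_mod n};
  res_aug : {linear res_mod 0%N -> M};
  res_projective : forall n, projective (res_mod n);
  res_aug_surj : is_surjective res_aug;
  res_exact0 : exact_at (res_diff 0%N) res_aug;
  res_exact : forall n, exact_at (res_diff n.+1) (res_diff n)
}.

(* The canonical free resolution: each kernel is covered by the free module on
   its underlying set. *)
Section FreeResolution.
Variables (R : pzRingType) (M : lmodType R).

Definition free_cover (N : lmodType R) : {linear free_mod R N -> N} := free_lift id.

Fixpoint free_syz n : lmodType R :=
  if n is n'.+1 then ker (free_cover (free_syz n')) else M.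

Definition free_res_mod n : lmodType R := free_mod R (free_syz n).

Definition free_res_diff n : {linear free_res_mod n.+1 -> free_res_mod n} :=
  (val : ker (free_cover (free_syz n)) -> free_res_mod n)
    \o free_cover (free_syz n.+1).

Lemma free_cover_surj (N : lmodType R) : is_surjective (free_cover N).
Proof. by move=> y; exists (free_gen R y); exact: free_lift_gen. Qed.

Lemma ker_valP (A B : lmodType R) (g : {linear A -> B}) (x : ker g) : g (\val x) = 0.
Proof. by apply/eqP; exact: (valP x). Qed.

Lemma free_res_exact0 : exact_at (free_res_diff 0) (free_cover M).
Proof.
move=> y; split=> [y0|[x <-]]; last exact: ker_valP.
have yk : y \in ker_pred (free_cover M) by rewrite inE y0.
by have [x xy] := free_cover_surj (Ker yk); exists x; rewrite /= xy.
Qed.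

Lemma free_res_exact n : exact_at (free_res_diff n.+1) (free_res_diff n).
Proof.
move=> y; split=> [y0|[x <-]]; last first.
  by rewrite /= ker_valP; exact: (raddf0 \val).
have yk : y \in ker_pred (free_cover (free_syz n.+1)).
  apply/ker_predP/val_inj; rewrite [LHS]y0; symmetry; exact: (raddf0 \val).
by have [x xy] := free_cover_surj (Ker yk); exists x; rewrite /= xy.
Qed.

Definition free_resolution : proj_resolution M :=
  ProjResolution (fun n => @free_projective R (free_syz n))
    (free_cover_surj (N := M)) free_res_exact0 free_res_exact.

End FreeResolution.

(* Ext^n_R(M, N) for an R-S-bimodule N, as a right S-module; in degree 0 it is
   Hom_R(M, N) itself instead of the isomorphic kernel of Hom_R(P_0, N) ->
   Hom_R(P_1, N). For right modules take N := right_mod U. *)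
Section Ext.
Variables (R S : pzRingType).

Definition Ext (n : nat) (M : lmodType R) (N : bimodType R S) : lmodType S^c :=
  if n is n'.+1 then
    let P := free_resolution M in
    homology (hom_precomp N (res_diff P n')) (hom_precomp N (res_diff P n'.+1))
  else lin_hom M N.

Definition grade_ge (A : lmodType R) (N : bimodType R S) (i : nat) :=
  forall j, (j < i)%N -> trivial_module (Ext j A N).

End Ext.

Section BimoduleConditions.
Variables (L G : pzRingType) (U : bimodType L G).

(* The natural map from L to End(U_G). *)
Definition left_mult_fun (a : L) (u : right_mod U) : right_mod U := a *: (u : U).

Fact left_mult_is_linear a : linear (left_mult_fun a).
Proof.
move=> s u v; rewrite [LHS](scalerDr a (s *: u : U)); congr (_ + _).
by symmetry; exact: (@rscaleC L G U).
Qed.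

HB.instance Definition _ a := GRing.isLinear.Build G^c (right_mod U) (right_mod U)
  _ (left_mult_fun a) (left_mult_is_linear a).

Definition left_mult (a : L) : lin_hom (right_mod U) (right_mod U) := left_mult_fun a.

(* The natural map from G to End(_L U)^op. *)
Definition right_mult_fun (b : G) (u : U) : U := rscale u b.

Fact right_mult_is_linear b : linear (right_mult_fun b).
Proof. by move=> r u v; rewrite /right_mult_fun rscaleDl rscaleC. Qed.

HB.instance Definition _ b := GRing.isLinear.Build L U U
  _ (right_mult_fun b) (right_mult_is_linear b).

Definition right_mult (b : G) : lin_hom U U := right_mult_fun b.

(* Both maps are ring morphisms, so that they are isomorphisms as soon as they
   are bijective. *)
Definition faithfully_balanced := bijective left_mult /\ bijective right_mult.

Definition selforthogonal := forall i, (0 < i)%N ->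
  trivial_module (Ext i U U) /\ trivial_module (Ext i (right_mod U) (right_mod U)).

(* X is isomorphic to a direct summand of a finite direct sum of copies of U. *)
Definition in_add (X : lmodType L) :=
  exists n (Y : lmodType L) (f : {linear (X * Y)%type -> {ffun 'I_n -> U}}),
    bijective f.

End BimoduleConditions.

(* There is an exact sequence 0 -> M -> X_0 -> ... -> X_{k-1} with all X_i in
   the class C; the terms X_i with k <= i are irrelevant. *)
Definition syzygy_of (R : pzRingType) (C : lmodType R -> Prop) (k : nat)
    (M : lmodType R) :=
  exists (X : nat -> lmodType R) (e : {linear M -> X 0%N})
         (d : forall i, {linear X i -> X i.+1}),
  [/\ forall i, (i < k)%N -> C (X i),
      injective e,
      (1 < k)%N -> exact_at e (d 0%N)
    & forall i, (i.+2 < k)%N -> exact_at (d i) (d i.+1)].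

Definition k_syzygy (R : pzRingType) (k : nat) (M : lmodType R) :=
  syzygy_of (fun P : lmodType R => fin_gen P /\ projective P) k M.

Definition U_k_syzygy (L G : pzRingType) (U : bimodType L G) (k : nat)
    (M : lmodType L) :=
  syzygy_of (in_add U) k M.

(* Main.v *)
(* Write X^* = Hom(X, U), and let 0 -> M -> P -> M' -> 0 be exact with P finitely
   generated projective and M' a t-th syzygy of C. Dualising gives
     0 -> M'^* -> P^* -> M^* -> E -> 0,   E = Ext^{t+1}(C, U),
   where P^* is a summand of a power of U_Gamma, so that Ext^n(P^*, U) = 0 for
   n > 0 and P = P^**. As E has grade at least t, induction on t shows that a
   t-th syzygy M embeds in M^** (t >= 1), is reflexive (t >= 2) and satisfies
   Ext^n(M^*, U) = 0 for 1 <= n <= t - 2. Finally M^* has a resolution by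
   finitely generated free Gamma-modules, and applying Hom(-, U) to it yields the
   required exact sequence 0 -> M -> U^(n_0) -> U^(n_1) -> ... *)

Require Import Defs.
From HB Require Import structures.
From mathcomp Require Import all_boot all_order all_algebra.
From mathcomp Require Import boolp.

Set Implicit Arguments.
Unset Strict Implicit.
Unset Printing Implicit Defensive.

Import GRing.Theory.
Local Open Scope ring_scope.

(** * Linear maps modulo projectives and comparison of syzygies *)

Section LinearMaps.
Variable R : pzRingType.
Implicit Types A B C D K L P Q : lmodType R.

Lemma linear_pack A B (f : A -> B) : linear f -> exists g : {linear A -> B}, g =1 f.
Proof.
move=> f_lin; pose m := GRing.isLinear.Build R A B *:%R f f_lin.
by exists (HB.pack f m : {linear A -> B}).
Qed.

Lemma inj_factor A B D (i : {linear A -> B}) (f : {linear D -> B}) :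
    injective i -> (forall x, exists y, i y = f x) ->
  exists g : {linear D -> A}, forall x, i (g x) = f x.
Proof.
move=> i_inj /choice[g gP].
have [|h hE] := @linear_pack D A g.
  by move=> a x y; apply: i_inj; rewrite !linearP !gP linearP.
by exists h => x; rewrite hE.
Qed.

Lemma surj_factor A B D (p : {linear A -> B}) (f : {linear A -> D}) :
    is_surjective p -> (forall x, p x = 0 -> f x = 0) ->
  exists g : {linear B -> D}, forall x, g (p x) = f x.
Proof.
move=> /choice[s sP] pf.
have f_eq x y : p x = p y -> f x = f y.
  move=> xy; apply/eqP; rewrite -subr_eq0 -linearB; apply/eqP/pf.
  by rewrite linearB xy subrr.
have [|h hE] := @linear_pack B D (f \o s).
  by move=> a x y /=; rewrite -linearP; apply: f_eq; rewrite linearP !sP.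
by exists h => x; rewrite hE /=; apply: f_eq; rewrite sP.
Qed.

Lemma linear_sum_maps A B n (h : 'I_n -> {linear A -> B}) :
  exists e : {linear A -> B}, forall x, e x = \sum_i h i x.
Proof.
have [|e eE] := @linear_pack A B (fun x => \sum_i h i x); last by exists e.
move=> a x y; rewrite scaler_sumr -big_split.
by apply: eq_bigr => i _; rewrite linearP.
Qed.

Definition short_exact A B C (i : {linear A -> B}) (p : {linear B -> C}) :=
  [/\ injective i, exact_at i p & is_surjective p].

(** For the inclusion of a syzygy in a projective module, this is the vanishing of Ext^1 of the
    quotient, phrased without homology. *)
Definition extends_along A B D (i : {linear A -> B}) :=
  forall f : {linear A -> D}, exists g : {linear B -> D}, forall x, g (i x) = f x.

Definition factors_through_projective A (h : A -> A) :=
  exists (P : lmodType R) (s : {linear A -> P}) (r : {linear P -> A}),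
    projective P /\ forall x, h x = r (s x).

(** Isomorphism in the stable category, where maps through a projective count as zero. *)
Definition stably_equivalent A B :=
  exists (f : {linear A -> B}) (g : {linear B -> A}),
    factors_through_projective (fun x => x - g (f x)) /\
    factors_through_projective (fun y => y - f (g y)).

(** [A] is a direct summand of a power of [B] in the stable category. *)
Definition in_stable_add B A :=
  exists n (f : 'I_n -> {linear A -> B}) (g : 'I_n -> {linear B -> A}),
    factors_through_projective (fun x => x - \sum_j g j (f j x)).

Lemma ker_short_exact A B (g : {linear A -> B}) :
  is_surjective g -> short_exact (val : ker g -> A) g.
Proof.
move=> g_surj; split=> //; first exact: val_inj.
move=> y; split=> [y0|[x <-]]; last exact: ker_valP.
have yk : y \in ker_pred g by rewrite inE y0.
by exists (Ker yk).
Qed.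

Lemma free_cover_short_exact A :
  short_exact (val : ker (free_cover A) -> free_mod R A) (free_cover A).
Proof. by apply: ker_short_exact; exact: free_cover_surj. Qed.

Lemma exact_comp0 A B C (i : {linear A -> B}) (p : {linear B -> C}) x :
  short_exact i p -> p (i x) = 0.
Proof. by case=> _ ex _; apply/ex; exists x. Qed.

Lemma lift_to_syzygies A B K P L Q (i : {linear K -> P}) (p : {linear P -> A})
    (j : {linear L -> Q}) (q : {linear Q -> B}) (f : {linear A -> B}) :
    projective P -> short_exact i p -> short_exact j q ->
  exists (ft : {linear P -> Q}) (fs : {linear K -> L}),
    (forall x, q (ft x) = f (p x)) /\ (forall x, j (fs x) = ft (i x)).
Proof.
move=> P_proj ip [j_inj jq q_surj].
have [ft ftP] := P_proj _ _ q (f \o p) q_surj.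
have [|fs fsP] := @inj_factor _ _ _ j (ft \o i) j_inj.
  by move=> x; apply/jq; rewrite /= ftP /= (exact_comp0 _ ip) linear0.
by exists ft, fs.
Qed.

(* If 1 - e = r s on A, then s followed by a lift of r maps A to P, and
   1 - et - (lift of r) s p sends P into K; on K it is 1 - es. *)
Lemma syzygy_endo A K P (i : {linear K -> P}) (p : {linear P -> A})
    (e : {linear A -> A}) (et : {linear P -> P}) (es : {linear K -> K}) :
    short_exact i p ->
    (forall x, p (et x) = e (p x)) -> (forall x, i (es x) = et (i x)) ->
    factors_through_projective (fun x => x - e x) ->
  exists t : {linear P -> K}, forall x, x - es x = t (i x).
Proof.
move=> ip pet ies [Q [s [r [Q_proj rs]]]].
have [i_inj ex p_surj] := ip.
have [rt rtP] := Q_proj _ _ p r p_surj.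
pose d : {linear P -> P} := idfun \- et \- (rt \o s \o p).
have [|t tP] := @inj_factor _ _ _ i d i_inj.
  move=> x; apply/ex; rewrite /d /= !linearB /= rtP pet rs subrr.
  by [].
exists t => x; apply: i_inj; rewrite tP /d /= (exact_comp0 _ ip) !linear0 addr0.
by rewrite linearB ies.
Qed.

Lemma factors_through_projective0 A (h : A -> A) :
  h =1 (fun=> 0) -> factors_through_projective h.
Proof.
move=> h0; exists (free_mod R nat), \0, \0; split; first exact: free_projective.
exact: h0.
Qed.

Lemma stably_equivalent_refl A : stably_equivalent A A.
Proof.
by exists idfun, idfun; split; apply: factors_through_projective0 => x;
  rewrite subrr.
Qed.

Section Syzygies.
Variables (A B K L P Q : lmodType R).
Variables (i : {linear K -> P}) (p : {linear P -> A}).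
Variables (j : {linear L -> Q}) (q : {linear Q -> B}).
Hypotheses (P_proj : projective P) (Q_proj : projective Q).
Hypotheses (ip : short_exact i p) (jq : short_exact j q).

(** [t] and [u] act as homotopies: being defined on the projectives, they make [fs] and [gs] stably
    inverse. The lifts [ft] and [gt] serve to transport presentations of Ext. *)
Lemma stably_equivalent_syzygies : stably_equivalent A B ->
  exists (ft : {linear P -> Q}) (fs : {linear K -> L})
         (gt : {linear Q -> P}) (gs : {linear L -> K})
         (t : {linear P -> K}) (u : {linear Q -> L}),
    [/\ forall x, j (fs x) = ft (i x), forall y, i (gs y) = gt (j y),
        forall x, x - gs (fs x) = t (i x) & forall y, y - fs (gs y) = u (j y)].
Proof.
move=> [f [g [fg gf]]].
have [ft [fs [ftP fsP]]] := lift_to_syzygies f P_proj ip jq.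
have [gt [gs [gtP gsP]]] := lift_to_syzygies g Q_proj jq ip.
have [||t tP] := @syzygy_endo A K P i p (g \o f) (gt \o ft) (gs \o fs) ip _ _ fg.
- by move=> x; rewrite /= gtP ftP.
- by move=> x; rewrite /= gsP fsP.
have [||u uP] := @syzygy_endo B L Q j q (f \o g) (ft \o gt) (fs \o gs) jq _ _ gf.
- by move=> x; rewrite /= ftP gtP.
- by move=> x; rewrite /= fsP gsP.
by exists ft, fs, gt, gs, t, u.
Qed.

Lemma stably_equivalent_syzygy : stably_equivalent A B -> stably_equivalent K L.
Proof.
move=> /stably_equivalent_syzygies[ft [fs [gt [gs [t [u [_ _ tP uP]]]]]]].
by exists fs, gs; split; [exists P, i, t|exists Q, j, u].
Qed.

Lemma in_stable_add_syzygies : in_stable_add B A ->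
  exists n (ft : 'I_n -> {linear P -> Q}) (fs : 'I_n -> {linear K -> L})
         (gs : 'I_n -> {linear L -> K}) (t : {linear P -> K}),
    (forall k x, j (fs k x) = ft k (i x)) /\
    (forall x, x - \sum_k gs k (fs k x) = t (i x)).
Proof.
move=> [n [f [g fg]]].
have /choice[ft /choice[fs fP]] k := lift_to_syzygies (f k) P_proj ip jq.
have /choice[gt /choice[gs gP]] k := lift_to_syzygies (g k) Q_proj jq ip.
have [e eE] := linear_sum_maps (fun k => g k \o f k).
have [et etE] := linear_sum_maps (fun k => gt k \o ft k).
have [es esE] := linear_sum_maps (fun k => gs k \o fs k).
have [| | |t tP] := @syzygy_endo A K P i p e et es ip.
- move=> x; rewrite eE etE linear_sum; apply: eq_bigr => k _ /=.
  by rewrite (gP k).1 (fP k).1.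
- move=> x; rewrite esE etE linear_sum; apply: eq_bigr => k _ /=.
  by rewrite (gP k).2 (fP k).2.
- have [X [s [r [X_proj rs]]]] := fg.
  by exists X, s, r; split=> // x; rewrite eE rs.
exists n, ft, fs, gs, t; split=> [k x|x]; first exact: (fP k).2.
by rewrite -tP esE.
Qed.

Lemma in_stable_add_syzygy : in_stable_add B A -> in_stable_add L K.
Proof.
move=> /in_stable_add_syzygies[n [ft [fs [gs [t [_ tP]]]]]].
by exists n, fs, gs, P, i, t.
Qed.

Lemma in_stable_add_extends D : in_stable_add B A ->
  extends_along D j -> extends_along D i.
Proof.
move=> /in_stable_add_syzygies[n [ft [fs [gs [t [ftP tP]]]]]] jD h.
have /choice[e eP] k := jD (h \o gs k).
have [w wE] := linear_sum_maps (fun k => e k \o ft k).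
(* On [K] the identity is [t \o i] plus the sum of the [gs k \o fs k]; the first part extends
   through [P], the second through the extensions [e k] to [Q]. *)
exists ((h \o t) \+ w) => x /=.
rewrite -tP wE linearB linear_sum -[RHS](subrK (\sum_k h (gs k (fs k x)))).
by congr (_ + _); apply: eq_bigr => k _ /=; rewrite -ftP eP.
Qed.

End Syzygies.

End LinearMaps.

(** * Ext through syzygies, and dimension shifting *)

Section ExtPresentation.
Variables (R S : pzRingType) (N : bimodType R S).
Implicit Types A B K L P Q : lmodType R.


(** A cocycle on [free_res_mod A n.+1] kills the kernel of the cover of the syzygy, hence descends
    to the syzygy. Coboundaries become the restrictions of maps on [free_res_mod A n]. *)
Lemma free_ext_presentation A n :
  exists pi : {linear lin_hom (free_syz A n.+1) N -> Ext n.+1 A N},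
    is_surjective pi /\
    exact_at (hom_precomp N
      (val : ker (free_cover (free_syz A n)) -> free_res_mod A n)) pi.
Proof.
pose c := free_cover (free_syz A n.+1).
pose d1 := free_res_diff A n.+1.
have cd x : c (d1 x) = 0 by rewrite /d1 /= ker_valP.
pose g := hom_precomp N d1.
have gc f : hom_precomp N c f \in ker_pred g.
  apply/ker_predP/homP => x /=.
  by rewrite [LHS](_ : _ = hom_fun f (c (d1 x)))// cd linear0.
pose pi0 f : Ext n.+1 A N :=
  @homology_class _ _ _ _ (hom_precomp N (free_res_diff A n)) g (Ker (gc f)).
have [|pi piE] := @linear_pack S^c (lin_hom (free_syz A n.+1) N) (Ext n.+1 A N) pi0.
  move=> a x y; transitivity (homology_class (hom_precomp N (free_res_diff A n))
    (a *: Ker (gc x) + Ker (gc y))).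
    by congr homology_class; apply: val_inj; rewrite /= linearP.
  by rewrite homology_classD; congr (_ + _); exact: homology_classZ.
exists pi; split=> [e|f].
  pose z : ker g := repr e.
  have [|h hP] := @surj_factor _ _ _ _ c (hom_fun (val z)) (@free_cover_surj _ _).
    move=> x /(@free_res_exact0 R (free_syz A n.+1) x).1 [y <-].
    have /(congr1 (fun f => hom_fun f y)) : g (val z) = 0 by exact: ker_valP.
    exact: id.
  exists h; rewrite piE -[e]homology_class_repr /pi0; congr homology_class.
  by apply: val_inj; apply: homP => x; exact: hP.
rewrite piE /pi0 homology_class_eq0; split=> -[x xP]; exists x.
  apply: homP => y; have [w <-] := free_cover_surj y.
  by have /(congr1 (fun f => hom_fun f w)) := xP.
apply: homP => y; have /(congr1 (fun f => hom_fun f (c y))) := xP.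
exact: id.
Qed.

(* By Schanuel-type comparison, the presentation of Ext by the canonical
   resolution transfers to any stably equivalent syzygy. *)
Lemma ext_presentation A n B L Q (j : {linear L -> Q}) (q : {linear Q -> B}) :
    projective Q -> short_exact j q -> stably_equivalent B (free_syz A n) ->
  exists pi : {linear lin_hom L N -> Ext n.+1 A N},
    is_surjective pi /\ exact_at (hom_precomp N j) pi.
Proof.
move=> Q_proj jq BA; have [pi [pi_surj pi_ex]] := free_ext_presentation A n.
have [ft [fs [gt [gs [t [u [fsP gsP tP uP]]]]]]] :=
  stably_equivalent_syzygies Q_proj (@free_projective _ _) jq
    (free_cover_short_exact _) BA.
exists (pi \o hom_precomp N gs); split=> [e|f].
  have [z <-] := pi_surj e; exists (hom_precomp N fs z).
  apply/eqP; rewrite -subr_eq0 -(linearB pi); apply/eqP/pi_ex.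
  pose zu : lin_hom (free_res_mod A n) N := hom_fun z \o u.
  exists (- zu); apply: homP => x.
  have zuE : hom_fun zu (val x) = hom_fun z x - hom_fun z (fs (gs x)).
    by rewrite -linearB uP.
  by rewrite [LHS](_ : _ = - hom_fun zu (val x))// zuE opprB.
split=> [/pi_ex[h hP]|[h hP]].
  have hE x : hom_fun h (val x) = hom_fun f (gs x).
    exact: (congr1 (fun f => hom_fun f x) hP).
  exists ((hom_fun h \o ft) \+ (hom_fun f \o t)); apply: homP => x /=.
  rewrite [LHS](_ : _ = hom_fun h (ft (j x)) + hom_fun f (t (j x)))//.
  by rewrite -tP -fsP hE -linearD addrC subrK.
apply/pi_ex; exists (hom_fun h \o gt); apply: homP => x.
rewrite [LHS](_ : _ = hom_fun h (gt (val x)))// -gsP.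
exact: (congr1 (fun f => hom_fun f (gs x)) hP).
Qed.

Lemma ext_trivialP A n B L Q (j : {linear L -> Q}) (q : {linear Q -> B}) :
    projective Q -> short_exact j q -> stably_equivalent B (free_syz A n) ->
  trivial_module (Ext n.+1 A N) <-> extends_along N j.
Proof.
move=> Q_proj jq /(ext_presentation Q_proj jq)[pi [pi_surj pi_ex]].
split=> [triv f|jN e].
  have [g gP] := (pi_ex f).1 (triv _); exists (hom_fun g) => x.
  exact: (congr1 (fun f => hom_fun f x) gP).
have [f <-] := pi_surj e; apply/pi_ex.
by have [g gP] := jN (hom_fun f); exists g; exact: homP.
Qed.

Section DimensionShift.
Variables (A K P : lmodType R) (i : {linear K -> P}) (p : {linear P -> A}).
Hypotheses (P_proj : projective P) (ip : short_exact i p).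

Lemma ext1_trivialP : trivial_module (Ext 1 A N) <-> extends_along N i.
Proof. exact: (@ext_trivialP A 0 _ _ _ _ _ P_proj ip (stably_equivalent_refl A)). Qed.

Lemma free_syz_stable n : stably_equivalent (free_syz K n) (free_syz A n.+1).
Proof.
elim: n => [|n IH].
  exact: (stably_equivalent_syzygy P_proj (@free_projective _ _) ip
    (free_cover_short_exact _) (stably_equivalent_refl A)).
exact: (stably_equivalent_syzygy (@free_projective _ _) (@free_projective _ _)
  (free_cover_short_exact _) (free_cover_short_exact _) IH).
Qed.

(** Both sides amount to extension along the same inclusion of [free_syz K n.+1], since
    [free_syz K n] and [free_syz A n.+1] are stably equivalent. *)
Lemma ext_shift n : trivial_module (Ext n.+2 A N) <-> trivial_module (Ext n.+1 K N).
Proof.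
have pr := @free_projective R (free_syz K n).
have se := free_cover_short_exact (free_syz K n).
rewrite (@ext_trivialP A n.+1 _ _ _ _ _ pr se (free_syz_stable n)).
by rewrite (@ext_trivialP K n _ _ _ _ _ pr se (stably_equivalent_refl _)).
Qed.

End DimensionShift.

Lemma ext_stable_add n A B :
  in_stable_add B A -> trivial_module (Ext n.+1 B N) -> trivial_module (Ext n.+1 A N).
Proof.
have pr C := @free_projective R C; have se := @free_cover_short_exact R.
elim: n A B => [|n IH] A B AB.
  rewrite (ext1_trivialP (pr _) (se B)) (ext1_trivialP (pr _) (se A)).
  exact: (in_stable_add_extends (pr _) (pr _) (se _) (se _) AB).
rewrite (ext_shift (pr _) (se B)) (ext_shift (pr _) (se A)); apply: IH.
exact: (in_stable_add_syzygy (pr _) (pr _) (se _) (se _) AB).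
Qed.

End ExtPresentation.

(** * Vanishing of Ext along short exact sequences *)

Section LongExactSequence.
Variables (R S : pzRingType) (N : bimodType R S).
Implicit Types A B C : lmodType R.

Local Notation v n A := (trivial_module (Ext n A N)).

(** Pulled back to the kernel of [p \o c], with [c] a free cover of [B], the map extends to the free
    module. The extension kills the kernel of [c] and so descends to [B]. *)
Lemma ext1_extends A B C (i : {linear A -> B}) (p : {linear B -> C}) :
  short_exact i p -> v 1 C -> extends_along N i.
Proof.
move=> ip; have [i_inj ex p_surj] := ip.
have F_proj := @free_projective R B.
pose c := free_cover B; have c_surj := @free_cover_surj _ B.
have pc_surj : is_surjective (p \o c).
  by move=> y; have [x <-] := p_surj y; have [w <-] := c_surj x; exists w.
move=> /(ext1_trivialP N F_proj (ker_short_exact pc_surj)) ext f.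
have [|q qP] := @inj_factor _ _ _ _ i (c \o (val : ker (p \o c) -> _)) i_inj.
  by move=> x; apply/ex; exact: (ker_valP x).
have [g gP] := ext (f \o q).
have kerg x : c x = 0 -> g x = 0.
  move=> cx0; have xk : x \in ker_pred (p \o c) by rewrite inE /= cx0 linear0.
  rewrite -[x]/(val (Ker xk)) gP /= (_ : q _ = 0) ?linear0 //.
  by apply: i_inj; rewrite qP linear0.
have [h hP] := surj_factor c_surj kerg.
exists h => x; have [w wP] := c_surj (i x).
have wk : w \in ker_pred (p \o c) by rewrite inE /= wP (exact_comp0 _ ip).
rewrite -wP hP -[w]/(val (Ker wk)) gP /=; congr (f _).
by apply: i_inj; rewrite qP.
Qed.

(* Covering B and C by the same projective F, the kernels K and L of F -> B and
   F -> C fit in 0 -> K -> L -> A -> 0. *)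
Lemma syzygy_rotation A B C (i : {linear A -> B}) (p : {linear B -> C}) :
    short_exact i p ->
  exists (K L F : lmodType R) (k : {linear K -> F}) (c : {linear F -> B})
         (l : {linear L -> F}) (j : {linear K -> L}) (q : {linear L -> A}),
    [/\ projective F, short_exact k c,
        short_exact l (p \o c : {linear F -> C}), short_exact j q &
        (forall x, l (j x) = k x) /\ (forall x, i (q x) = c (l x))].
Proof.
move=> ip; have [i_inj ex p_surj] := ip.
pose c := free_cover B; have c_surj := @free_cover_surj _ B.
have pc_surj : is_surjective (p \o c).
  by move=> y; have [x <-] := p_surj y; have [w <-] := c_surj x; exists w.
have se := ker_short_exact c_surj; have [k_inj kc _] := se.
have sel := ker_short_exact pc_surj; have [l_inj lpc _] := sel.
have [|q qP] := @inj_factor _ _ _ _ i (c \o (val : ker (p \o c) -> _)) i_inj.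
  by move=> x; apply/ex; exact: (ker_valP x).
have [|j jP] := @inj_factor _ _ _ _ (val : ker (p \o c) -> _) (val : ker c -> _) l_inj.
  by move=> x; apply/lpc; rewrite /= ker_valP linear0.
exists (ker c), (ker (p \o c)), (free_mod R B), val, c, val, j, q.
split=> //; first exact: free_projective.
split.
- by move=> x y xy; apply: k_inj; rewrite -!jP xy.
- move=> y; split=> [qy|[x <-]].
    have [x xP] : exists x : ker c, val x = val y.
      by apply/kc; have := qP y; rewrite qy linear0.
    by exists x; apply: l_inj; rewrite jP.
  apply: i_inj; transitivity (c (val (j x))); first exact: qP.
  by rewrite jP ker_valP linear0.
move=> a; have [w wP] := c_surj (i a).
have [y yP] : exists y : ker (p \o c), val y = w.
  by apply/lpc; rewrite /= wP (exact_comp0 _ ip).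
by exists y; apply: i_inj; rewrite qP /= yP wP.
Qed.

(** The extension hypothesis says that the connecting map from Hom(A, N) to Ext^1(C, N) is zero. *)
Lemma ext1_right A B C (i : {linear A -> B}) (p : {linear B -> C}) :
  short_exact i p -> v 1 B -> extends_along N i -> v 1 C.
Proof.
move=> ip; have [K [L [F [k [c [l [j [q [F_pr kc lpc jq [ljk iqc]]]]]]]]]] :=
  syzygy_rotation ip.
rewrite (ext1_trivialP N F_pr kc) (ext1_trivialP N F_pr lpc) => extB exti f.
have [g gP] := extB (f \o j).
have [_ jqex q_surj] := jq.
have [|h hP] := @surj_factor _ _ _ _ q (f \- (g \o l)) q_surj.
  by move=> x /jqex[y <-] /=; rewrite ljk gP subrr.
have [h' h'P] := exti h.
exists ((h' \o c) \+ g) => x /=.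
by rewrite -iqc h'P hP /= subrK.
Qed.

Lemma ext1_middle A B C (i : {linear A -> B}) (p : {linear B -> C}) :
  short_exact i p -> v 1 A -> v 1 C -> v 1 B.
Proof.
move=> ip vA; have [K [L [F [k [c [l [j [q [F_pr kc lpc jq [ljk _]]]]]]]]]] :=
  syzygy_rotation ip.
rewrite (ext1_trivialP N F_pr kc) (ext1_trivialP N F_pr lpc) => extC f.
have [g gP] := ext1_extends jq vA f; have [h hP] := extC g.
by exists h => x; rewrite -ljk hP gP.
Qed.

(** Rotation replaces the triple by [K], [L], [A], with [K] and [L] first syzygies of [B] and [C].
    Each implication then becomes another of the three, so they are proved together. *)
Lemma ext_long_exact n A B C (i : {linear A -> B}) (p : {linear B -> C}) :
    short_exact i p ->
  [/\ v n.+1 B -> v n.+2 C -> v n.+1 A,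
      v n.+1 A -> v n.+1 C -> v n.+1 B
    & v n.+1 A -> v n.+2 B -> v n.+2 C].
Proof.
elim: n A B C i p => [|n IH] A B C i p ip;
  have [K [L [F [k [c [l [j [q [F_pr kc lpc jq [ljk iqc]]]]]]]]]] :=
    syzygy_rotation ip.
  split.
  - rewrite (ext1_trivialP N F_pr kc) (ext_shift N F_pr lpc) => extB vL.
    apply: (ext1_right jq) => // f; have [g gP] := extB f.
    by exists (g \o l) => x /=; rewrite ljk gP.
  - exact: (ext1_middle ip).
  rewrite (ext_shift N F_pr kc) (ext_shift N F_pr lpc) => vA vK.
  exact: (ext1_middle jq).
(* Stated for every short exact sequence, because the third implication applies it to the rotated
   one. *)
have middle A' B' C' (i' : {linear A' -> B'}) (p' : {linear B' -> C'}) :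
    short_exact i' p' -> v n.+2 A' -> v n.+2 C' -> v n.+2 B'.
  move=> ip' vA; have [K' [L' [F' [k' [c' [l' [j' [q' [F_pr' kc' lpc' jq' _]]]]]]]]] :=
    syzygy_rotation ip'.
  rewrite (ext_shift N F_pr' kc') (ext_shift N F_pr' lpc').
  by have [LA _ _] := IH _ _ _ _ _ jq'; move=> vL; exact: LA.
have [_ _ LC] := IH _ _ _ _ _ jq.
split; [|exact: middle ip|];
  rewrite (ext_shift N F_pr kc) (ext_shift N F_pr lpc); first exact: LC.
by move=> vA vK; exact: (middle _ _ _ _ _ jq).
Qed.

End LongExactSequence.

(** * Finite free modules and dual bases *)

Section FiniteFree.
Variables (R : pzRingType) (n : nat).

Definition free_coord (k : 'I_n) (f : free_mod R 'I_n) : R^o := f k.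

Fact free_coord_is_linear k : linear (free_coord k).
Proof. by []. Qed.

HB.instance Definition _ k :=
  GRing.isLinear.Build R (free_mod R 'I_n) R^o _ (free_coord k)
    (free_coord_is_linear k).

Lemma free_lift_sum (M : lmodType R) (h : 'I_n -> M) (f : free_mod R 'I_n) :
  free_lift h f = \sum_k (free_coord k f : R) *: h k.
Proof.
have [|g gE] := @linear_pack R (free_mod R 'I_n) M
    (fun f => \sum_k (free_coord k f : R) *: h k).
  move=> a x y; rewrite scaler_sumr -big_split; apply: eq_bigr => k _ /=.
  rewrite [X in X *: _ = _](_ : _ = a * (free_coord k x : R) + free_coord k y)//.
  by rewrite scalerDl scalerA.
rewrite -gE; apply: (@free_hom_eq _ _ _ (free_lift h) g) => l.
rewrite [LHS]free_lift_gen gE; transitivity (\sum_k ((k == l)%:R : R) *: h k).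
  by rewrite (bigD1 l) //= eqxx scale1r big1 ?addr0 // => k /negPf ->; rewrite scale0r.
by apply: eq_bigr.
Qed.

Lemma free_lift_surj (M : lmodType R) (e : 'I_n -> M) :
  generated_by predT e -> is_surjective (free_lift e).
Proof.
move=> [_ gen] x; have [//|c ->] := gen x.
exists (\sum_k c k *: free_gen R k); rewrite linear_sum.
by apply: eq_bigr => k _; rewrite linearZ /= free_lift_gen.
Qed.

End FiniteFree.

(** The functionals are the coordinates of a section of a finite free cover. *)
Lemma dual_basis (R : pzRingType) (P : lmodType R) : fin_gen P -> projective P ->
  exists n (e : 'I_n -> P) (phi : 'I_n -> {linear P -> R^o}),
    forall x, x = \sum_k (phi k x : R) *: e k.
Proof.
move=> [n [e gen]] P_proj; have [s sP] := P_proj _ _ _ idfun (free_lift_surj gen).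
exists n, e, (fun k => @free_coord R n k \o s) => x.
by rewrite -free_lift_sum sP.
Qed.

(** * Duality into U and the torsionfree step *)

Section Duality.
Variables (L G : pzRingType) (U : bimodType L G).
Implicit Types (M P : lmodType L) (E : lmodType G^c).

Local Notation v n E := (trivial_module (Ext n E (right_mod U))).
Local Notation dual M := (lin_hom M U).

(** Injectivity of evaluation from [M] to its bidual; [bidual_onto] is its surjectivity. *)
Definition torsionless M := forall m : M, (forall f : dual M, hom_fun f m = 0) -> m = 0.

Definition bidual_onto M :=
  forall F : {linear dual M -> right_mod U}, exists m, forall f, F f = hom_fun f m.

Section Step.
Variables (M P M' : lmodType L) (i : {linear M -> P}) (p : {linear P -> M'}).
Hypothesis (ip : short_exact i p).
Variables (E : lmodType G^c) (pi : {linear dual M -> E}).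
Hypotheses (pi_surj : is_surjective pi) (pi_ex : exact_at (hom_precomp U i) pi).

Lemma torsionless_sub : torsionless P -> torsionless M.
Proof.
have [i_inj _ _] := ip.
move=> torP m m0; apply: i_inj; rewrite linear0; apply: torP => f.
exact: (m0 (hom_precomp U i f)).
Qed.

(** Pulled back to the dual of [P], [F] is evaluation at some [x]. As [M'] is torsionless, [x] dies
    there and comes from some [m]. Then [F] minus evaluation at [m] factors through [E], and Hom(E,
    U) is zero. *)
Lemma bidual_onto_step :
  torsionless M' -> bidual_onto P -> v 0 E -> bidual_onto M.
Proof.
have [i_inj ex p_surj] := ip.
move=> torM' ontoP vE F; have [x xP] := ontoP (F \o hom_precomp U i).
have [m mx] : exists m, i m = x.
  apply/ex/torM' => f.
  transitivity (F (hom_precomp U i (hom_precomp U p f))).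
    by rewrite -[LHS](xP (hom_precomp U p f)).
  rewrite (_ : hom_precomp U i _ = 0) ?linear0 //; apply: homP => y.
  by rewrite [LHS](_ : _ = hom_fun f (p (i y)))// (exact_comp0 _ ip) linear0.
have [|ev evE] := @linear_pack _ (dual M) (right_mod U) (fun f => F f - hom_fun f m).
  move=> a f g; rewrite linearP scalerBr.
  by rewrite [X in _ - X](_ : _ = a *: (hom_fun f m : right_mod U) + hom_fun g m)//
    opprD addrACA.
have [|h hP] := @surj_factor _ _ _ _ pi ev pi_surj.
  move=> _ /pi_ex[f <-]; rewrite evE; apply/eqP; rewrite subr_eq0; apply/eqP.
  by rewrite [LHS]xP -mx.
exists m => f; apply/eqP; rewrite -subr_eq0 -evE -hP.
by rewrite (congr1 (fun h => hom_fun h (pi f)) (vE h)).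
Qed.

(** Cuts the dualised sequence at the kernel of [pi], which is the image of the dual of [P]. *)
Lemma dual_kernel_short_exact :
  exists q : {linear dual P -> ker pi}, short_exact (hom_precomp U p) q.
Proof.
have [i_inj ex p_surj] := ip; have [v_inj vE _] := ker_short_exact pi_surj.
have [|q qP] := @inj_factor _ _ _ _ (val : ker pi -> dual M) (hom_precomp U i) v_inj.
  by move=> f; apply/vE/pi_ex; exists f.
exists q; split.
- move=> f g fg; apply: homP => y; have [x <-] := p_surj y.
  exact: (congr1 (fun f => hom_fun f x) fg).
- move=> f; split=> [qf|[g <-]].
    have [|g gP] := @surj_factor _ _ _ _ p (hom_fun f) p_surj.
      move=> x /ex[m <-]; have := qP f; rewrite qf linear0.
      by move/(congr1 (fun f => hom_fun f m)).
    by exists g; exact: homP.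
  apply: v_inj; rewrite qP linear0; apply: homP => x.
  by rewrite [LHS](_ : _ = hom_fun g (p (i x)))// (exact_comp0 _ ip) linear0.
move=> z; have [f fz] := (pi_ex (val z)).1 (ker_valP z).
by exists f; apply: v_inj; rewrite qP.
Qed.

Lemma ext1_dual_step :
  v 1 (dual P) -> bidual_onto M' -> v 1 E -> v 1 (dual M).
Proof.
have [i_inj ex p_surj] := ip.
move=> vP ontoM' vE; have [q pq] := dual_kernel_short_exact.
apply: (ext1_middle (ker_short_exact pi_surj)) => //.
(* A functional on the dual of [M'] is evaluation at some [m]; evaluation at a preimage of [m] in
   [P] extends it. *)
apply: (ext1_right pq vP) => F; have [m mP] := ontoM' F.
have [x xm] := p_surj m.
have [|ev evE] := @linear_pack _ (dual P) (right_mod U) (fun f => hom_fun f x).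
  by [].
by exists ev => f; rewrite evE mP -xm.
Qed.

Lemma ext_dual_step n :
  v n.+2 (dual P) -> v n.+1 (dual M') -> v n.+2 E -> v n.+2 (dual M).
Proof.
move=> vP vM' vE; have [q pq] := dual_kernel_short_exact.
have [_ _ kerE] := ext_long_exact (right_mod U) n pq.
have [_ mid _] := ext_long_exact (right_mod U) n.+1 (ker_short_exact pi_surj).
by apply: mid => //; exact: kerE.
Qed.

End Step.

Section Projective.
Variable P : lmodType L.
Hypotheses (P_fg : fin_gen P) (P_proj : projective P).
Hypotheses (U_balanced : faithfully_balanced U) (U_selforth : selforthogonal U).

(* With a dual basis (e_k, phi_k) of P, the maps f |-> f (e_k) and
   u |-> phi_k(-) u exhibit P^* as a direct summand of a sum of copies of U. *)
Lemma dual_projective : exists n (e : 'I_n -> P) (phi : 'I_n -> {linear P -> L^o})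
    (a : 'I_n -> {linear dual P -> right_mod U})
    (b : 'I_n -> {linear right_mod U -> dual P}),
  [/\ forall k f, a k f = hom_fun f (e k),
      forall k u x, hom_fun (b k u) x = (phi k x : L) *: (u : U),
      forall x, x = \sum_k (phi k x : L) *: e k &
      forall f, f = \sum_k b k (a k f)].
Proof.
have [n [e [phi eP]]] := dual_basis P_fg P_proj.
have /choice[a aE] k := @linear_pack _ (dual P) (right_mod U) (fun f => hom_fun f (e k))
  (fun _ _ _ => erefl).
have /choice[b0 b0E] (ku : 'I_n * U) : exists g : {linear P -> U},
    forall x, g x = (phi ku.1 x : L) *: ku.2.
  apply: linear_pack => r x y.
  by rewrite linearP scalerDl scalerA.
have bl k : linear (fun u : right_mod U => b0 (k, u) : dual P).
  move=> r u w; apply: homP => x.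
  rewrite [LHS](b0E (k, _)) [RHS](_ : _ = rscale (b0 (k, u) x) (r : G) + b0 (k, w) x)//.
  by rewrite !b0E /= scalerDr rscaleC.
have /choice[b bE] k := linear_pack (bl k).
exists n, e, phi, a, b; split=> // [k u x|f]; first by rewrite bE b0E.
apply: homP => x; rewrite {1}[x]eP.
have -> : hom_fun (\sum_k b k (a k f)) x = \sum_k hom_fun (b k (a k f)) x.
  by elim/big_rec2: _ => [//|k y g _ <-].
by rewrite linear_sum; apply: eq_bigr => k _; rewrite linearZ /= bE b0E /= aE.
Qed.

(** If every functional kills [x], each coordinate [phi k x] annihilates [U], hence is zero because
    [left_mult] is injective. *)
Lemma projective_torsionless : torsionless P.
Proof.
have [n [e [phi [a [b [aE bE eP _]]]]]] := dual_projective.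
move=> x x0; rewrite [x]eP big1 // => k _.
have [m' mK _] := U_balanced.1.
rewrite (_ : phi k x = 0) ?scale0r //; apply: (can_inj mK); apply: homP => u.
rewrite [RHS](_ : _ = (0 : L) *: (u : U))// scale0r.
by rewrite -[RHS](x0 (b k u)) bE.
Qed.

Lemma projective_bidual_onto : bidual_onto P.
Proof.
have [n [e [phi [a [b [aE bE eP fE]]]]]] := dual_projective.
move=> F; have [m' _ mK] := U_balanced.1.
(* [F \o b k] is an endomorphism of [right_mod U], so balance makes it left multiplication by a
   scalar. *)
pose l k := m' (F \o b k).
exists (\sum_k l k *: e k) => f.
rewrite {1}[f]fE !linear_sum; apply: eq_bigr => k _.
rewrite linearZ /= -aE.
symmetry; exact: (congr1 (fun h => hom_fun h (a k f)) (mK (F \o b k))).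
Qed.

Lemma ext_dual_projective n : v n.+1 (dual P).
Proof.
have [m [e [phi [a [b [_ _ _ fE]]]]]] := dual_projective.
apply: (@ext_stable_add _ _ _ n _ (right_mod U)); last first.
  by have [] := U_selforth (ltn0Sn n).
exists m, a, b; apply: factors_through_projective0 => f.
by rewrite -fE subrr.
Qed.

End Projective.

(** The degree is [n.+1], so the bound [n.+2 < t] covers exactly the degrees from 1 to t - 2. *)
Definition torsionfree t M :=
  [/\ (0 < t)%N -> torsionless M, (1 < t)%N -> bidual_onto M &
      forall n, (n.+2 < t)%N -> v n.+1 (dual M)].

Lemma torsionfree_step t (M P M' : lmodType L) (i : {linear M -> P})
    (p : {linear P -> M'}) E (pi : {linear dual M -> E}) :
    faithfully_balanced U -> selforthogonal U ->
    fin_gen P -> projective P -> short_exact i p ->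
    is_surjective pi -> exact_at (hom_precomp U i) pi ->
  grade_ge E (right_mod U) t -> torsionfree t M' -> torsionfree t.+1 M.
Proof.
move=> bal orth Pfg Ppr ip pi_surj pi_ex gr [tor onto ext].
have torP := projective_torsionless Pfg Ppr bal.
have ontoP := projective_bidual_onto Pfg Ppr bal.
split=> [_|t1|[|n] nt]; first exact: (torsionless_sub ip).
- by apply: (bidual_onto_step ip pi_surj pi_ex) => //; [exact: tor|exact: gr].
- apply: (ext1_dual_step ip pi_surj pi_ex); [|exact: onto|exact: gr].
  exact: ext_dual_projective.
apply: (ext_dual_step ip pi_surj pi_ex); [|exact: ext|exact: gr].
exact: ext_dual_projective.
Qed.

End Duality.

(** * Finite generation over noetherian rings *)

Section Noetherian.
Variable R : pzRingType.
Implicit Types A B K M : lmodType R.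

Lemma fin_gen_fintype M (I : finType) (e : I -> M) :
  (forall x, exists c : I -> R, x = \sum_i c i *: e i) -> fin_gen M.
Proof.
move=> gen; exists #|I|, (e \o enum_val); split=> // x _.
have [c ->] := gen x; exists (c \o enum_val).
by rewrite (reindex (@enum_val I I)) //; exists enum_rank => j _;
  rewrite ?enum_valK ?enum_rankK.
Qed.

Lemma fin_gen_surj A B (p : {linear A -> B}) :
  is_surjective p -> fin_gen A -> fin_gen B.
Proof.
move=> p_surj [n [e [_ gen]]]; exists n, (p \o e); split=> // y _.
have [x <-] := p_surj y; have [//|c ->] := gen x; exists c.
by rewrite linear_sum; apply: eq_bigr => k _; rewrite linearZ.
Qed.

Lemma fin_gen_free n : fin_gen (free_mod R 'I_n).
Proof.
exists n, (@free_gen R 'I_n); split=> // x _.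
by exists ((@free_coord R n)^~ x); rewrite {1}[x]free_genE free_lift_sum.
Qed.

Hypothesis noeth : left_noetherian R.

(* Induction on n: the coefficients of e_0 in elements of S form a left ideal. *)
Lemma noetherian_subspan M n (e : 'I_n -> M) (S : {pred M}) :
    submod_closed S ->
    (forall x, x \in S -> exists c : 'I_n -> R, x = \sum_k c k *: e k) ->
  exists m (g : 'I_m -> M), generated_by S g.
Proof.
elim: n e S => [|n IH] e S S_closed S_span.
  exists 0%N, (fun=> 0); split=> [[]//|x /S_span[c ->]].
  by exists (fun=> 0); rewrite !big_ord0.
have [S0 Slin] := S_closed.
have SZ a : {in S, forall x, a *: x \in S}.
  by move=> x xS; rewrite -[_ *: _]addr0 Slin.
have SN : {in S &, forall x y, y - x \in S}.
  by move=> x y xS yS; rewrite addrC -scaleN1r Slin.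
have Ssum m (c : 'I_m -> R) (h : 'I_m -> M) :
    (forall k, h k \in S) -> \sum_k c k *: h k \in S.
  move=> hS; apply: (big_ind (fun x => x \in S)) => // [x y xS yS|k _].
    by rewrite -[x]scale1r Slin.
  exact: SZ.
pose e' := e \o lift ord0.
pose I : {pred R^o} := fun r => `[< exists c : 'I_n -> R,
  (r : R) *: e ord0 + \sum_k c k *: e' k \in S >].
have I_closed : submod_closed I.
  split=> [|a x y /asboolP[c cS] /asboolP[d dS]]; apply/asboolP.
    by exists (fun=> 0); rewrite scale0r add0r big1 // => k _; rewrite scale0r.
  exists (fun k => a * c k + d k).
  have -> : \sum_k (a * c k + d k) *: e' k
      = a *: (\sum_k c k *: e' k) + \sum_k d k *: e' k.
    rewrite scaler_sumr -big_split; apply: eq_bigr => k _ /=.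
    by rewrite scalerDl scalerA.
  rewrite [X in X *: e ord0](_ : _ = a * (x : R) + y)// scalerDl -scalerA addrACA.
  by rewrite -scalerDr Slin.
have [m [r [rI r_gen]]] := noeth I_closed.
have /choice[c cS] k : exists c : 'I_n -> R,
    (r k : R) *: e ord0 + \sum_l c l *: e' l \in S by apply/asboolP; exact: rI.
pose s k := (r k : R) *: e ord0 + \sum_l c k l *: e' l.
pose S' : {pred M} := fun x =>
  (x \in S) && `[< exists c : 'I_n -> R, x = \sum_k c k *: e' k >].
have S'P x : reflect (x \in S /\ exists c : 'I_n -> R, x = \sum_k c k *: e' k) (x \in S').
  by apply: (iffP andP) => -[? /asboolP].
have [|x /S'P[]//|m' [g [gS g_gen]]] := IH e' S'.
  split=> [|a x y /S'P[xS [d xd]] /S'P[yS [d' yd]]]; apply/S'P; split=> //.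
  - by exists (fun=> 0); rewrite big1 // => k _; rewrite scale0r.
  - exact: Slin.
  exists (fun k => a * d k + d' k).
  rewrite xd yd scaler_sumr -big_split; apply: eq_bigr => k _ /=.
  by rewrite scalerDl scalerA.
exists (m + m')%N, (fun k => match split k with inl j => s j | inr j => g j end).
split=> [k|x xS].
  by case: (split k) => j; [exact: cS|have /S'P[] := gS j].
have [d xd] := S_span x xS; rewrite big_ord_recl in xd.
have [|a aE] := r_gen (d ord0 : R^o).
  by apply/asboolP; exists (d \o lift ord0); rewrite -xd.
(* Subtracting this combination cancels the coefficient of [e ord0], so the remainder lies in
   [S']. *)
have [|b bE] := g_gen (x - \sum_k a k *: s k).
  apply/S'P; split; first by apply: SN => //; exact: Ssum.
  exists (fun l => d (lift ord0 l) - \sum_k a k * c k l).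
  have -> : \sum_k a k *: s k = d ord0 *: e ord0
      + \sum_l (\sum_k a k * c k l) *: e' l.
    rewrite aE scaler_suml; under [X in _ = _ + X]eq_bigr do rewrite scaler_suml.
    rewrite exchange_big -big_split; apply: eq_bigr => k _ /=.
    rewrite scalerDr scalerA; congr (_ + _); rewrite scaler_sumr.
    by apply: eq_bigr => l _; rewrite scalerA.
  rewrite {1}xd opprD addrACA subrr add0r -sumrB.
  by apply: eq_bigr => l _; rewrite scalerBl.
exists (fun k => match split k with inl j => a j | inr j => b j end).
rewrite big_split_ord /= -[LHS](subrK (\sum_k a k *: s k)) {1}bE [LHS]addrC.
by congr (_ + _); apply: eq_bigr => k _;
  [rewrite -[lshift _ k]/(unsplit (inl k))|rewrite -[rshift _ k]/(unsplit (inr k))];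
  rewrite unsplitK.
Qed.

Lemma noetherian_sub K M (i : {linear K -> M}) :
  injective i -> fin_gen M -> fin_gen K.
Proof.
move=> i_inj [n [e [_ gen]]].
pose S : {pred M} := fun x => `[< exists y, i y = x >].
have [||m [g [gS g_gen]]] := @noetherian_subspan M n e S.
- split=> [|a x y /asboolP[x' <-] /asboolP[y' <-]]; apply/asboolP.
    by exists 0; rewrite linear0.
  by exists (a *: x' + y'); rewrite linearP.
- by move=> x _; exact: gen.
have /choice[h hP] k : exists y, i y = g k by apply/asboolP; exact: gS.
exists m, h; split=> // x _.
have [|c cE] := g_gen (i x); first by apply/asboolP; exists x.
exists c; apply: i_inj; rewrite cE linear_sum.
by apply: eq_bigr => k _; rewrite linearZ /= hP.
Qed.

End Noetherian.

(** * Resolutions by finitely generated free modules *)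

Section FinitelyGeneratedResolution.
Variables (R : pzRingType) (noeth : left_noetherian R).

Section Cover.
Variables (A : lmodType R) (A_fg : fin_gen A).

(** Choice fixes one generating family, so that covers and syzygies can be defined by recursion. *)
Definition fg_rank : nat := projT1 (cid A_fg).
Definition fg_gens : 'I_fg_rank -> A := projT1 (cid (projT2 (cid A_fg))).

Lemma fg_gensP : generated_by predT fg_gens.
Proof. exact: (projT2 (cid (projT2 (cid A_fg)))). Qed.

Definition fg_cover : {linear free_mod R 'I_fg_rank -> A} := free_lift fg_gens.

Lemma fg_cover_short_exact :
  short_exact (val : ker fg_cover -> free_mod R 'I_fg_rank) fg_cover.
Proof. by apply: ker_short_exact; exact: (free_lift_surj fg_gensP). Qed.

Lemma fg_cover_ker : fin_gen (ker fg_cover).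
Proof.
apply: (@noetherian_sub _ noeth _ _ (val : ker fg_cover -> free_mod R 'I_fg_rank)).
  exact: val_inj.
exact: fin_gen_free.
Qed.

Lemma fg_gens_eq (N : lmodType R) (f g : {linear A -> N}) :
  (forall k, f (fg_gens k) = g (fg_gens k)) -> f =1 g.
Proof.
move=> fg x; have [_ gen] := fg_gensP; have [//|c ->] := gen x.
by rewrite !linear_sum; apply: eq_bigr => k _; rewrite !linearZ fg.
Qed.

(** Left exactness of Hom(-, N): a map on the free module is a tuple in [N], and it descends to [A]
    exactly when it kills the relations. *)
Lemma fg_kills_relations (N : lmodType R) (u : 'I_fg_rank -> N) :
  (forall x : ker fg_cover, free_lift u (val x) = 0) <->
  exists w : {linear A -> N}, forall k, w (fg_gens k) = u k.
Proof.
split=> [u0|[w wE] x]; last first.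
  transitivity (w (fg_cover (val x))); last by rewrite ker_valP linear0.
  rewrite /fg_cover /= !free_lift_sum linear_sum; apply: eq_bigr => k _.
  by rewrite linearZ /= wE.
have [w_inj ex p_surj] := fg_cover_short_exact.
have [|w wE] := @surj_factor _ _ _ _ fg_cover (free_lift u) p_surj.
  by move=> x /ex[y <-]; exact: u0.
by exists w => k; rewrite -[RHS](free_lift_gen u) -[RHS]wE /= free_lift_gen.
Qed.

End Cover.

Fixpoint fg_syz (A : lmodType R) (A_fg : fin_gen A) i :
    {B : lmodType R & fin_gen B} :=
  if i is i'.+1 then
    let B_fg := projT2 (fg_syz A_fg i') in
    existT (@fin_gen R) (ker (fg_cover B_fg)) (fg_cover_ker B_fg)
  else existT (@fin_gen R) A A_fg.

End FinitelyGeneratedResolution.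

(** * The coresolution of M by powers of U *)

Section Coresolution.
Variables (L G : pzRingType) (U : bimodType L G).
Local Notation v n E := (trivial_module (Ext n E (right_mod U))).

Lemma in_add_free n : in_add U {ffun 'I_n -> U}.
Proof.
(* The complement is the power of [U] with exponent zero, a zero module. *)
exists n, {ffun 'I_0 -> U}, fst; exists (fun x => (x, 0)) => //.
move=> [x y]; congr pair; apply/ffunP => -[]//.
Qed.

(** A finite free cover of [M] embeds its dual in the dual of a free module. The latter is a summand
    of a power of [right_mod U], generated by the [b k (u l)]. *)
Lemma fin_gen_dual (M : lmodType L) :
    faithfully_balanced U -> selforthogonal U -> right_noetherian G ->
    fin_gen (right_mod U) -> fin_gen M ->
  fin_gen (lin_hom M U).
Proof.
move=> bal orth noeth [m [u [_ u_gen]]] [n [e gen]].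
have p_surj := free_lift_surj gen; pose p := free_lift e.
apply: (@noetherian_sub _ noeth _ _ (hom_precomp U p)).
  move=> f g fg; apply: homP => y; have [x <-] := p_surj y.
  exact: (congr1 (fun f => hom_fun f x) fg).
have [r [x [phi [a [b [_ _ _ fE]]]]]] :=
  dual_projective U (fin_gen_free L n) (@free_projective L 'I_n).
apply: (@fin_gen_fintype _ _ ('I_r * 'I_m)%type (fun kl => b kl.1 (u kl.2))) => f.
have /choice[c cE] k := u_gen (a k f) isT.
exists (fun kl => c kl.1 kl.2).
rewrite -(pair_bigA _ (fun k l => c k l *: b k (u l))) /= {1}[f]fE.
apply: eq_bigr => k _; rewrite {1}cE linear_sum; apply: eq_bigr => l _.
by rewrite linearZ.
Qed.

Lemma free_lift_left_linear n (a : L) (x y : 'I_n -> U) (f : free_mod G^c 'I_n) :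
  free_lift (fun k => a *: x k + y k : right_mod U) f =
  a *: (free_lift (x : 'I_n -> right_mod U) f : U) +
  free_lift (y : 'I_n -> right_mod U) f.
Proof.
have sumE (z : 'I_n -> U) : free_lift (z : 'I_n -> right_mod U) f =
  \sum_k rscale (z k) (free_coord k f : G) :> U.
  by etransitivity; [exact: (@free_lift_sum _ _ (right_mod U))|exact: erefl].
rewrite [LHS]sumE !sumE scaler_sumr -big_split; apply: eq_bigr => k _ /=.
by rewrite rscaleDl rscaleC.
Qed.

Section Dual.
Variables (M : lmodType L) (noeth : right_noetherian G).
Hypothesis (dual_fg : fin_gen (lin_hom M U : lmodType G^c)).

Let A_fg i := projT2 (fg_syz noeth dual_fg i).
Let n i := fg_rank (A_fg i).

Lemma ext_fg_syz i k :
  v (i + k).+1 (lin_hom M U) -> v k.+1 (projT1 (fg_syz noeth dual_fg i)).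
Proof.
elim: i k => [//|i IH] k; rewrite addSnnS => /IH.
exact: (ext_shift _ (@free_projective _ _) (fg_cover_short_exact (A_fg i)) k).1.
Qed.

(** Evaluation into the bidual, followed by the embedding of the bidual in Hom(F_0, U), read as
    tuples of values on the basis of the free cover F_0. *)
Definition dual_coaug (m : M) : {ffun 'I_(n 0) -> U} :=
  [ffun j => hom_fun (fg_gens (A_fg := A_fg 0) j : lin_hom M U) m].

Fact dual_coaug_is_linear : linear dual_coaug.
Proof. by move=> a x y; apply/ffunP => j; rewrite !ffunE linearP. Qed.

HB.instance Definition _ := GRing.isLinear.Build L M {ffun 'I_(n 0) -> U} _
  dual_coaug dual_coaug_is_linear.

(** Hom(-, U) of the differential of the free resolution, in the same coordinates. *)
Definition dual_codiff i (u : {ffun 'I_(n i) -> U}) : {ffun 'I_(n i.+1) -> U} :=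
  [ffun j => free_lift (u : 'I_(n i) -> right_mod U)
    (val (fg_gens (A_fg := A_fg i.+1) j : ker (fg_cover (A_fg i))))].

Fact dual_codiff_is_linear i : linear (@dual_codiff i).
Proof.
move=> a x y; apply/ffunP => j; rewrite !ffunE -free_lift_left_linear.
apply: (congr1 (fun h => @free_lift _ _ (right_mod U) h _)).
by apply/funext => k; rewrite !ffunE.
Qed.

HB.instance Definition _ i := GRing.isLinear.Build L {ffun 'I_(n i) -> U}
  {ffun 'I_(n i.+1) -> U} _ (@dual_codiff i) (@dual_codiff_is_linear i).

Lemma dual_codiff_eq0 i (u : {ffun 'I_(n i) -> U}) :
  dual_codiff u = 0 <->
  exists w : {linear projT1 (fg_syz noeth dual_fg i) -> right_mod U},
    forall j, w (fg_gens (A_fg := A_fg i) j) = u j.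
Proof.
rewrite -fg_kills_relations; split=> [/ffunP u0 x|u0]; last first.
  by apply/ffunP => j; rewrite !ffunE u0.
pose f : {linear ker (fg_cover (A_fg i)) -> right_mod U} :=
  free_lift (u : 'I_(n i) -> right_mod U) \o val.
apply: (@fg_gens_eq _ _ (A_fg i.+1) _ f \0) => j.
by have := u0 j; rewrite !ffunE.
Qed.

(** A kernel element is a map on the syzygy of index [i.+1]. It extends to the free cover of the
    syzygy of index [i], whose Ext^1 vanishes by dimension shifting. *)
Lemma dual_codiff_exact i : v i.+1 (lin_hom M U) ->
  exact_at (@dual_codiff i) (@dual_codiff i.+1).
Proof.
move=> vi; have {}vi : v 1 (projT1 (fg_syz noeth dual_fg i)).
  by apply: ext_fg_syz; rewrite addn0.
have se := fg_cover_short_exact (A_fg i).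
move: vi; rewrite (ext1_trivialP _ (@free_projective _ _) se) => ext u.
rewrite dual_codiff_eq0; split=> [[w wE]|[x <-]].
  have [g gE] := ext w.
  exists [ffun l => g (free_gen _ l)]; apply/ffunP => j; rewrite ffunE -wE -gE.
  rewrite free_lift_sum /= {2}[val _]free_genE free_lift_sum linear_sum.
  by apply: eq_bigr => l _; rewrite linearZ ffunE.
exists (free_lift (x : 'I_(n i) -> right_mod U) \o val) => j.
by rewrite ffunE.
Qed.

Lemma dual_coaug_inj : torsionless U M -> injective dual_coaug.
Proof.
move=> tor x y /ffunP xy; apply/eqP; rewrite -subr_eq0; apply/eqP/tor => f.
have [|ev evE] := @linear_pack _ (lin_hom M U) (right_mod U)
  (fun f => hom_fun f (x - y)); first by [].
rewrite -[LHS]evE; apply: (@fg_gens_eq _ _ (A_fg 0) _ ev \0) => j.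
rewrite evE linearB; apply/eqP; rewrite subr_eq0; apply/eqP.
by have := xy j; rewrite !ffunE.
Qed.

Lemma dual_coaug_exact : bidual_onto U M -> exact_at dual_coaug (@dual_codiff 0).
Proof.
move=> onto u; rewrite dual_codiff_eq0; split=> [[w wE]|[m <-]].
  have [m mE] := onto w; exists m; apply/ffunP => j.
  by rewrite ffunE -wE mE.
have [|ev evE] := @linear_pack _ (lin_hom M U) (right_mod U)
  (fun f => hom_fun f m); first by [].
by exists ev => j; rewrite evE ffunE.
Qed.

Lemma torsionfree_U_k_syzygy k : (0 < k)%N -> torsionfree U k M -> U_k_syzygy U k M.
Proof.
move=> k_gt0 [tor onto ext].
exists (fun i => {ffun 'I_(n i) -> U} : lmodType L), dual_coaug, (@dual_codiff).
split=> [i _|||i ik]; first exact: in_add_free.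
- exact/dual_coaug_inj/tor.
- by move=> /onto; exact: dual_coaug_exact.
by apply: dual_codiff_exact; exact: ext.
Qed.

End Dual.
End Coresolution.

(** * Cosyzygies and their stable equivalence with free syzygies *)

Section Cosyzygies.
Variable R : pzRingType.
Implicit Types A B C M P : lmodType R.

Lemma cokernel_exists A B (f : {linear A -> B}) :
  exists C (p : {linear B -> C}), is_surjective p /\ exact_at f p.
Proof.
(* With zero as second map every element of [B] is a cycle, so the homology is the cokernel of
   [f]. *)
pose z : {linear B -> B} := \0.
have zk b : b \in ker_pred z by rewrite inE.
have [|p pE] := @linear_pack _ B (homology f z) (fun b => homology_class f (Ker (zk b))).
  move=> a x y; transitivity (homology_class f (a *: Ker (zk x) + Ker (zk y))).
    by congr homology_class; apply: val_inj.
  by rewrite homology_classD; congr (_ + _); exact: homology_classZ.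
exists (homology f z), p; split=> [c|b]; last by rewrite pE homology_class_eq0.
exists (val (repr c : ker z)); rewrite pE -[RHS]homology_class_repr.
by congr homology_class; apply: val_inj.
Qed.

(** A syzygy sequence cut into short exact ones, with [C] the last cokernel. *)
Fixpoint cosyzygy t M C : Prop :=
  if t is t'.+1 then
    exists P M' (i : {linear M -> P}) (p : {linear P -> M'}),
      [/\ fin_gen P, projective P, short_exact i p & cosyzygy t' M' C]
  else M = C.

Lemma k_syzygy_cosyzygy t M : k_syzygy t M -> exists C, cosyzygy t M C.
Proof.
elim: t M => [|t IH] M; first by exists M.
move=> [X [e [d [X_fgp e_inj ed dd]]]].
have [M' [p [p_surj ep]]] := cokernel_exists e.
suff [C MC] : exists C, cosyzygy t M' C.
  by have [] := X_fgp 0%N isT; exists C, (X 0%N), M', e, p.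
(* For [t = 0] no term after [X 0] is left, and [M'] itself is the last cokernel. *)
case: t IH X_fgp ed dd => [|t] IH X_fgp ed dd; first by exists M'.
have {}ed := ed isT.
have [|e' e'E] := @surj_factor _ _ _ _ p (d 0%N) p_surj.
  by move=> x /ep ex; apply/ed.
apply: IH; exists (fun i => X i.+1), e', (fun i => d i.+1); split.
- by move=> i it; exact: X_fgp.
(* Injectivity of [e'] is exactness of the given sequence at [X 0]. *)
- apply: raddf_inj => y; have [x <-] := p_surj y.
  by move=> px0; apply/ep/ed; rewrite -[LHS]e'E.
- move=> t1 y; rewrite (dd 0%N) //; split=> -[x <-].
    by exists (p x); exact: e'E.
  by have [w <-] := p_surj x; exists w; symmetry; exact: e'E.
- by move=> i it; exact: dd.
Qed.

Lemma cosyzygy_fin_gen t M C : cosyzygy t M C -> fin_gen M -> fin_gen C.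
Proof.
elim: t M => [|t IH] M /= => [<-//|[P [M' [i [p [P_fg _ [_ _ p_surj] MC]]]]]] _.
by apply: IH MC _; exact: fin_gen_surj P_fg.
Qed.

(** Lets Ext of [C] in degree [t.+1] be presented by any short exact sequence ending in [M] with
    projective middle term. *)
Lemma cosyzygy_stable t M C : cosyzygy t M C -> stably_equivalent M (free_syz C t).
Proof.
elim: t M => [|t IH] M /= => [<-|[P [M' [i [p [_ P_proj ip /IH MC]]]]]].
  exact: stably_equivalent_refl.
exact: (stably_equivalent_syzygy P_proj (@free_projective _ _) ip
  (free_cover_short_exact _) MC).
Qed.

End Cosyzygies.

(** * Torsionfreeness of iterated syzygies and the conclusion *)

Lemma cosyzygy_torsionfree (L G : pzRingType) (U : bimodType L G) k (C : lmodType L) :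
    faithfully_balanced U -> selforthogonal U ->
    (forall i, (1 <= i <= k - 1)%N -> grade_ge (Ext i.+1 C U) (right_mod U) i) ->
  forall t M, (t <= k)%N -> cosyzygy t M C -> torsionfree U t M.
Proof.
move=> bal orth grC; elim=> [|t IH] M tk; first by move=> _; split.
move=> [P [M' [i [p [P_fg P_proj ip MC]]]]].
have [pi [pi_surj pi_ex]] := ext_presentation U P_proj ip (cosyzygy_stable MC).
apply: (torsionfree_step bal orth P_fg P_proj ip pi_surj pi_ex).
  (* Grade at least zero is vacuous, so the grade hypothesis enters only for 1 to k - 1. *)
  case: t tk {IH MC pi pi_surj pi_ex} => // t tk.
  by apply: grC; rewrite leq_subRL ?add1n // (leq_trans _ tk).
by apply: IH MC; exact: ltnW.
Qed.

Theorem lemma3p2 (Lam Gam : pzRingType) (U : bimodType Lam Gam) (k : nat)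
  (noethLam : left_noetherian Lam /\ right_noetherian Lam)
  (noethGam : left_noetherian Gam /\ right_noetherian Gam)
  (U_fg_left : fin_gen U) (U_fg_right : fin_gen (right_mod U))
  (U_balanced : faithfully_balanced U) (U_selforth : selforthogonal U)
  (k_gt0 : (0 < k)%N)
  (grade_Ext : forall M : lmodType Lam, fin_gen M ->
     forall i : nat, (1 <= i <= k - 1)%N ->
     grade_ge (Ext i.+1 M U) (right_mod U) i) :
  forall M : lmodType Lam, fin_gen M -> k_syzygy k M -> U_k_syzygy U k M.
Proof.
move=> M M_fg /k_syzygy_cosyzygy[C MC].
have dual_fg := fin_gen_dual U_balanced U_selforth noethGam.2 U_fg_right M_fg.
apply: (torsionfree_U_k_syzygy noethGam.2 dual_fg k_gt0).
apply: (cosyzygy_torsionfree U_balanced U_selforth _ (leqnn k) MC).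
(* The grade hypothesis concerns finitely generated modules; [C] is one, being reached through
   quotients of finitely generated projectives. *)
by apply: grade_Ext; exact: cosyzygy_fin_gen MC M_fg.
Qed.
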